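(* Let $n \ge 3$ be an integer and let $G = L(S(C_n))$ be the line graph of the subdivision graph of the cycle $C_n$ with $n$ vertices. Then the F-index of $G$ is $F(G) = 16n$.
   Context: For a simple graph $H$, $d(u)$ denotes the degree of a vertex $u$ in $H$. The F-index of $H$ is $F(H) = \sum_{u \in V(H)} d^3(u) = \sum_{uv \in E(H)} [d^2(u)+d^2(v)]$. The subdivision graph $S(H)$ is the graph obtained from $H$ by inserting one additional vertex into each edge of $H$ (each edge is replaced by a path of length 2). The line graph $L(H)$ is the simple graph whose vertices are the edges of $H$, two distinct ones being adjacent when they share a common endpoint in $H$. $C_n$ is the cycle on $n$ vertices. *)

(* Defs.v *)
From mathcomp Require Import all_boot.

Set Implicit Arguments.
Unset Strict Implicit.
Unset Printing Implicit Defensive.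

Record sgraph := SGraph {
  vertex :> finType;
  adj : rel vertex;
  adj_sym : symmetric adj;
  adj_irrefl : irreflexive adj
}.

Definition edges (H : sgraph) : {set {set H}} :=
  [set e : {set H} | [exists x : H, exists y : H, adj x y && (e == [set x; y])]].

Definition edge (H : sgraph) : finType := {e : {set H} | e \in edges H}.

Definition degree (H : sgraph) (u : H) : nat := #|[set v | adj u v]|.

Definition F_index (H : sgraph) : nat := \sum_(u : H) degree u ^ 3.

Lemma edgesP (H : sgraph) (e : {set H}) :
  reflect (exists x y, adj x y /\ e = [set x; y]) (e \in edges H).
Proof.
rewrite inE; apply: (iffP existsP) => [[x /existsP[y]] | [x [y [xy ->]]]].
  by case/andP=> xy /eqP ->; exists x, y.
by exists x; apply/existsP; exists y; rewrite xy eqxx.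
Qed.

Lemma degree_edges (H : sgraph) (u : H) :
  degree u = #|[set e in edges H | u \in e]|.
Proof.
have inj : {in [set v | adj u v] &, injective (fun v => [set u; v])}.
  move=> v w; rewrite !inE => uv uw eq_vw.
  have: v \in [set u; w] by rewrite -eq_vw set22.
  by rewrite !inE => /orP[] /eqP // vu; rewrite vu adj_irrefl in uv.
rewrite /degree -(card_in_imset inj); congr #|pred_of_set _|.
apply/setP=> e; rewrite inE; apply/imsetP/andP => [[v] | [/edgesP[x [y [xy ->]]]]].
  by rewrite inE => uv ->; split; [apply/edgesP; exists u, v | rewrite set21].
rewrite !inE => /orP[] /eqP ->; first by exists y; rewrite ?inE.
by exists x; rewrite ?inE ?(adj_sym y) // setUC.
Qed.

(* The second expression for the F-index, a sum over edges uv of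
   d(u)^2 + d(v)^2. *)
Lemma F_index_edges (H : sgraph) :
  F_index H = \sum_(e in edges H) \sum_(u in e) degree u ^ 2.
Proof.
rewrite (exchange_big_dep xpredT) //=; apply: eq_bigr => u _.
rewrite sum_nat_const expnS {1}degree_edges; congr (_ * _).
by apply: eq_card => e; rewrite [LHS]inE.
Qed.

(* The vertices of the subdivision graph are the old vertices together with one
   new vertex for each edge. *)
Definition subdivision_adj (H : sgraph) : rel (H + edge H) := fun a b =>
  match a, b with
  | inl v, inr e | inr e, inl v => v \in val e
  | _, _ => false
  end.

Lemma subdivision_adj_sym (H : sgraph) : symmetric (@subdivision_adj H).
Proof. by move=> [v|e] [w|f]. Qed.

Lemma subdivision_adj_irrefl (H : sgraph) : irreflexive (@subdivision_adj H).
Proof. by move=> [v|e]. Qed.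

Definition subdivision (H : sgraph) : sgraph :=
  SGraph (@subdivision_adj_sym H) (@subdivision_adj_irrefl H).

Definition line_adj (H : sgraph) : rel (edge H) := fun e f =>
  (e != f) && [exists v : H, (v \in val e) && (v \in val f)].

Lemma line_adj_sym (H : sgraph) : symmetric (@line_adj H).
Proof.
move=> e f; rewrite /line_adj eq_sym; congr (_ && _).
by apply: eq_existsb => v; rewrite andbC.
Qed.

Lemma line_adj_irrefl (H : sgraph) : irreflexive (@line_adj H).
Proof. by move=> e; rewrite /line_adj eqxx. Qed.

Definition line_graph (H : sgraph) : sgraph :=
  SGraph (@line_adj_sym H) (@line_adj_irrefl H).

(* [ordS] is the successor modulo n.  This is the cycle C_n for n >= 3 only;
   the clause [i != j] is needed just for irreflexivity when n = 1. *)
Definition cycle_adj (n : nat) : rel 'I_n := fun i j =>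
  (i != j) && ((j == ordS i) || (i == ordS j)).

Lemma cycle_adj_sym (n : nat) : symmetric (@cycle_adj n).
Proof. by move=> i j; rewrite /cycle_adj eq_sym orbC. Qed.

Lemma cycle_adj_irrefl (n : nat) : irreflexive (@cycle_adj n).
Proof. by move=> i; rewrite /cycle_adj eqxx. Qed.

Definition cycle_graph (n : nat) : sgraph :=
  SGraph (@cycle_adj_sym n) (@cycle_adj_irrefl n).

(* Main.v *)
Require Import Defs.
From mathcomp Require Import all_boot.

(** Every vertex of [L(S(C_n))] has degree 2, and there are [2n] of them, so
    the F-index is [2n * 2 ^ 3].

    Both facts come from the 2-regularity of [C_n] (this is where [3 <= n] is
    needed: the two neighbours of a vertex are distinct).  Subdividing keeps
    the old degrees and adds vertices of degree 2, so it preserves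
    2-regularity; so does the line graph, since the edge [xy] meets
    [d(x) + d(y) - 2] other edges ([degree_line_graph]).  Moreover, by the
    handshake lemma ([sum_degree]), a 2-regular graph has as many edges as
    vertices.  Hence [C_n] has [n] edges, [S(C_n)] has [n + n] vertices and
    as many edges, and these edges are the vertices of [L(S(C_n))]. *)

Definition regular (k : nat) (H : sgraph) := forall u : H, degree u = k.

Lemma card_edges_pair (H : sgraph) (e : {set H}) : e \in edges H -> #|e| = 2.
Proof.
case/edgesP=> x [y [xy ->]]; rewrite cards2.
by case: eqVneq xy => [-> | //]; rewrite adj_irrefl.
Qed.

Lemma card_edge (H : sgraph) : #|edge H| = #|edges H|.
Proof. by rewrite card_sig. Qed.

Lemma card_incident (H : sgraph) (u : H) :
  #|[set e : edge H | u \in val e]| = degree u.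
Proof.
rewrite degree_edges -(card_imset _ val_inj); apply: eq_card => e.
rewrite inE; apply/imsetP/andP => [[f] | [He ue]].
  by rewrite inE => uf ->; split; first exact: valP f.
by exists (Sub e He); rewrite ?inE.
Qed.

(** Count the pairs of a vertex and an edge containing it in two ways. *)
Lemma sum_degree (H : sgraph) : \sum_(u : H) degree u = 2 * #|edges H|.
Proof.
under eq_bigr do rewrite degree_edges -sum1dep_card.
rewrite (exchange_big_dep (mem (edges H))) /=; last by move=> u e _ /andP[].
rewrite mulnC -sum_nat_const; apply: eq_bigr => e He.
by under eq_bigl do rewrite He; rewrite sum1_card card_edges_pair.
Qed.

Lemma regular2_card_edges (H : sgraph) : regular 2 H -> #|edges H| = #|H|.
Proof.
move=> reg; apply/eqP; rewrite -(eqn_pmul2l (isT : 0 < 2)) -sum_degree.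
by under eq_bigr do rewrite reg; rewrite sum_nat_const mulnC.
Qed.

Lemma degree_subdivision_old (H : sgraph) (v : H) :
  degree (inl v : subdivision H) = degree v.
Proof.
rewrite -(card_incident _ v) -(card_imset _ (@inr_inj H (edge H))).
apply: eq_card => -[w | e]; rewrite inE /=; last first.
  by rewrite mem_imset ?inE //; exact: inr_inj.
by apply/esym/negbTE/imsetP => -[].
Qed.

Lemma degree_subdivision_new (H : sgraph) (e : edge H) :
  degree (inr e : subdivision H) = 2.
Proof.
rewrite -(card_edges_pair _ _ (valP e)).
rewrite -(card_imset _ (@inl_inj H (edge H))).
apply: eq_card => -[v | f]; rewrite inE /=.
  by rewrite mem_imset //; exact: inl_inj.
by apply/esym/negbTE/imsetP => -[].
Qed.

Lemma regular2_subdivision (H : sgraph) :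
  regular 2 H -> regular 2 (subdivision H).
Proof.
move=> reg [v | e]; first by rewrite degree_subdivision_old.
exact: degree_subdivision_new.
Qed.

(** The edges meeting [e] are those at [x] together with those at [y]; since
    the graph is simple, [e] is the only edge counted twice, and it has to be
    discarded once more because it is not its own neighbour. *)
Lemma degree_line_graph (H : sgraph) (e : edge H) (x y : H) :
    x != y -> val e = [set x; y] ->
  degree (e : line_graph H) + 2 = degree x + degree y.
Proof.
move=> xy def_e; rewrite -(card_incident _ x) -(card_incident _ y) -cardsUI.
set I := fun u => [set f : edge H | u \in val f].
rewrite -/(I x) -/(I y).
have -> : I x :&: I y = [set e].
  apply/setP=> f; rewrite !inE -val_eqE def_e eq_sym eqEcard.
  rewrite (card_edges_pair _ _ (valP f)) cards2 xy andbT.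
  by rewrite subUset !sub1set.
rewrite cards1 (cardsD1 e) !inE def_e set21 /= [RHS]addnAC [RHS]addnC; congr (_ + _).
apply: eq_card => f; rewrite !inE /= /line_adj eq_sym; congr (_ && _).
apply/existsP/orP => [[v] | [xf | yf]].
- by rewrite def_e !inE => /andP[/orP[] /eqP -> vf]; [left | right].
- by exists x; rewrite def_e set21.
- by exists y; rewrite def_e set22.
Qed.

Lemma regular2_line_graph (H : sgraph) :
  regular 2 H -> regular 2 (line_graph H).
Proof.
move=> reg e; have /edgesP[x [y [xy def_e]]] := valP e.
have neq_xy : x != y by apply: contraTneq xy => ->; rewrite adj_irrefl.
by apply: (@addIn 2); rewrite (degree_line_graph _ _ _ _ neq_xy def_e) !reg.
Qed.

(** For [n >= 3] the successor of [i], its predecessor and [i] itself are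
    distinct modulo [n]. *)
Lemma regular2_cycle (n : nat) : 3 <= n -> regular 2 (cycle_graph n).
Proof.
move=> hn i.
have shift k : 0 < k < n -> (i + k) %% n != i.
  case/andP=> k_gt0 lt_kn; rewrite -[X in _ != X](modn_small (ltn_ord i)).
  by rewrite -[X in _ != X %% _]addn0 eqn_modDl mod0n modn_small // -lt0n.
have iS : ordS i != i.
  by rewrite -val_eqE /= -addn1 shift //= ltnW.
have iSS : ordS (ordS i) != i.
  by rewrite -val_eqE /= -addn1 modnDml addn1 -addn2 shift.
have iP : ord_pred i != i by apply: contraNneq iS => {1}<-; rewrite ord_predK.
have PS : ordS i != ord_pred i.
  by apply: contraNneq iSS => ->; rewrite ord_predK.
have <- : #|[set ordS i; ord_pred i]| = 2 by rewrite cards2 PS.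
apply: eq_card => j; rewrite !inE /= /cycle_adj.
rewrite (eq_sym i (ordS j)) (can2_eq (@ordSK _) (@ord_predK _)).
by apply: andb_idl => /orP[] /eqP ->; rewrite eq_sym.
Qed.

Theorem theorem1 (n : nat) (hn : 3 <= n) :
  F_index (line_graph (subdivision (cycle_graph n))) = 16 * n.
Proof.
have regC := regular2_cycle n hn.
have regS := regular2_subdivision _ regC.
rewrite /F_index; under eq_bigr do rewrite (regular2_line_graph _ regS).
rewrite sum_nat_const card_edge (regular2_card_edges _ regS) card_sum.
by rewrite card_edge (regular2_card_edges _ regC) card_ord addnn -mul2n mulnAC.
Qed.
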